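(* Let $\varrho=(w_0,w_1)$ be a primitive, binary constant-length substitution of length $L\geqslant 2$. Suppose that $\varrho$ is bijective and that $w_0$ is neither a palindrome nor an anti-palindrome. Then the maximal Lyapunov exponent of the matrix cocycle defined by the Fourier matrix of $\varrho$ satisfies $\chi^{B}_{\max}\geqslant\log(\tau)$, where $\tau=\frac12(1+\sqrt5)$ is the golden ratio.
   Context: A binary constant-length substitution $\varrho=(w_0,w_1)$ of length $L\geqslant 2$ is the map $0\mapsto w_0$, $1\mapsto w_1$, where $w_0,w_1$ are words of length $L$ over the alphabet $\{0,1\}$. Positions in words are indexed from $0$ to $L-1$. The substitution matrix is $M_\varrho=(m_{ij})_{0\leqslant i,j\leqslant 1}$, with $m_{ij}$ the number of occurrences of the letter $i$ in $w_j$; $\varrho$ is primitive if $M_\varrho$ is a primitive matrix (some power has only strictly positive entries). The substitution is bijective if $w_0$ and $w_1$ have different letters at every position. A word is a palindrome if it equals its reversal, and an anti-palindrome if its reversal equals the word obtained from it by interchanging the letters $0$ and $1$. The Fourier matrix of $\varrho$ is the $2\times 2$ matrix $B(k)=(B_{ij}(k))_{0\leqslant i,j\leqslant 1}$, $k\in\mathbb{R}$, with $B_{ij}(k)=\sum_{m\in T_{ij}} e^{2\pi i k m}$ (in the exponent, $i$ is the imaginary unit), where $T_{ij}$ is the set of positions $m$ at which the letter $i$ occurs in $w_j$. The cocycle is $B^{(n)}(k)=B(k)B(Lk)\cdots B(L^{n-1}k)$, and $\chi^B_{\max}$ is the number such that $\chi^B_{\max}=\lim_{n\to\infty}\frac1n\log\|B^{(n)}(k)\|$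 for Lebesgue-almost every $k\in\mathbb{R}$, for any matrix norm (the limit exists and is constant almost everywhere). *)

(* Defs.v *)
From HB Require Import structures.
From mathcomp Require Import all_boot all_order all_algebra.
From mathcomp Require Import complex.
From mathcomp Require Import all_classical all_reals all_analysis.

Set Implicit Arguments.
Unset Strict Implicit.
Unset Printing Implicit Defensive.

Import Order.TTheory GRing.Theory Num.Theory.
Import numFieldNormedType.Exports.

Local Open Scope classical_set_scope.
Local Open Scope ring_scope.

(* The letters 0 and 1 are the elements of 'I_2, so that they also index the
   rows and columns of the matrices; on 'I_2, rev_ord interchanges them. *)
Definition substitution (L : nat) := 'I_2 -> L.-tuple 'I_2.

Definition mk_substitution (L : nat) (w0 w1 : L.-tuple 'I_2) :
  substitution L := fun j => if j == 0 then w0 else w1.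

Definition subst_mx (L : nat) (rho : substitution L) : 'M[nat]_2 :=
  \matrix_(i, j) count_mem i (rho j).

Definition primitive_mx (M : 'M[nat]_2) : Prop :=
  exists n : nat, forall i j : 'I_2, (0 < (M ^+ n) i j)%N.

Definition primitive_subst (L : nat) (rho : substitution L) : Prop :=
  primitive_mx (subst_mx rho).

Definition bijective_subst (L : nat) (rho : substitution L) : Prop :=
  forall m : 'I_L, tnth (rho 0) m != tnth (rho 1) m.

Definition palindrome (w : seq 'I_2) : bool := rev w == w.

Definition antipalindrome (w : seq 'I_2) : bool :=
  rev w == map (@rev_ord 2) w.

Section Cocycle.
Variable R : realType.

Definition expi (x : R) : R[i] := (cos x +i* sin x)%C.

Definition fourier_mx (L : nat) (rho : substitution L) (k : R) : 'M[R[i]]_2 :=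
  \matrix_(i, j)
    \sum_(m < L | tnth (rho j) m == i) expi (2 * pi * k * (m : nat)%:R).

(* The factors are multiplied from left to right:
   B k * B (L k) * ... * B (L ^ (n - 1) k) *)
Definition cocycle (L : nat) (B : R -> 'M[R[i]]_2) (n : nat) (k : R) :
  'M[R[i]]_2 := \prod_(0 <= l < n) B (L%:R ^+ l * k).

Definition is_mx_norm (N : 'M[R[i]]_2 -> R) : Prop :=
  [/\ forall A, N A = 0 -> A = 0,
      forall (a : R[i]) A, N (a *: A) = Normc.normc a * N A
    & forall A A', N (A + A') <= N A + N A'].

(* The logarithm is extended-real valued, so that log 0 = -oo.  The term of
   index 0 of the sequence is irrelevant. *)
Definition is_max_lyapunov (L : nat) (B : R -> 'M[R[i]]_2)
    (N : 'M[R[i]]_2 -> R) (chi : R) : Prop :=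
  {ae @lebesgue_measure R, forall k : R,
    ((n%:R^-1)%:E * lne (N (cocycle L B n k))%:E)%E @[n --> \oo] --> chi%:E}.

Definition golden_ratio : R := (1 + Num.sqrt 5) / 2.

End Cocycle.

(* Main.v *)
(** The Fourier matrices B(k) all have the form x I + b J with J the all-ones
    matrix, and x = P(e(k)), where e(k) = exp(2 pi i k) and P is the polynomial
    with coefficients +1, -1 read off w_0.  The x-part of a product is the
    product of the x-parts, so N(B^(n)(k)) >= c |prod_(l < n) P(e(L^l k))|.

    As w_0 is neither a palindrome nor an anti-palindrome, P differs from plus or
    minus its reversal P', hence from their normalizations with constant
    coefficient 1, whose first difference is a coefficient +2 or -2.  Following
    Borwein, Hare and Mossinghoff, for every polynomial q with q(0) = 1 one of
    P q, P' q (normalized) then has a coefficient of modulus at least 1 besides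
    its constant coefficient 1, and Parseval gives sup |P q| >= tau on the unit
    circle.  Reflecting the roots of P lying in the open disc yields a polynomial
    F with |F| = |P| on the circle, whose inverse is approximated by such q up to
    the factor F(0); thus |F(0)| >= tau.

    Put H_n = prod_(l < n) F(X^(L^l)).  Jensen's inequality bounds the mean over
    the circle of log max(1, |H_n|) below by log |H_n(0)| >= n log tau.  It is
    used in discrete form, through the maximum modulus principle for
    prod_(j < m) H_n(e(j/m) X) and Riemann sums, so that no logarithmic
    singularity is ever integrated.  If chi < log tau, the bounded functions
    log max(1, |H_n|) / n would be eventually below some X < log tau almost
    everywhere, contradicting dominated convergence. *)

Require Import Defs.
From mathcomp Require Import all_boot all_order all_algebra.
From mathcomp Require Import complex zify ring lra.
From mathcomp Require Import all_classical all_reals all_analysis.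
From mathcomp Require Import measurable_realfun.

Set Implicit Arguments.
Unset Strict Implicit.
Unset Printing Implicit Defensive.

Import Order.TTheory GRing.Theory Num.Theory.
Import numFieldNormedType.Exports.
Import Normc.

Local Open Scope classical_set_scope.
Local Open Scope ring_scope.

(** * Moduli of polynomials on the unit circle *)

(** After expanding the squares, each off-diagonal pair contributes a geometric sum over a root of
    unity other than 1, which vanishes; [size p <= n] keeps distinct exponents distinct modulo n. *)
Lemma parseval_unity (C : numClosedFieldType) n (w : C) (p : {poly C}) :
  n.-primitive_root w -> (size p <= n)%N ->
  \sum_(j < n) `|p.[w ^+ j]| ^+ 2 = n%:R * \sum_(i < n) `|p`_i| ^+ 2.
Proof.
move=> wP szp; have wn1 := prim_expr_order wP.
have n_gt0 := prim_order_gt0 wP.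
have w1 : `|w| = 1.
  have /eqP := congr1 Num.norm wn1; rewrite normrX normr1 pexpr_eq1 //.
  by move=> /eqP.
have w0 : w != 0 by rewrite -normr_eq0 w1 oner_eq0.
have cw : w^* = w^-1.
  by apply: (mulfI w0); rewrite -normCK w1 expr1n mulfV.
have E (j : 'I_n) : `|p.[w ^+ j]| ^+ 2 =
    \sum_(i < n) \sum_(i' < n) p`_i * (p`_i')^* * (w ^+ i / w ^+ i') ^+ j.
  rewrite normCK (horner_coef_wide _ szp) rmorph_sum /= mulr_suml.
  apply: eq_bigr => i _; rewrite mulr_sumr; apply: eq_bigr => i' _.
  rewrite rmorphM !rmorphXn /= cw exprMn exprVn !exprVn -!exprM ![(j * _)%N]mulnC.
  by rewrite mulrACA.
under eq_bigr do rewrite E.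
rewrite exchange_big mulr_sumr; apply: eq_bigr => i _.
rewrite exchange_big (bigD1 i) //= [X in _ + X]big1 ?addr0 => [|i' ii'].
  under eq_bigr => j _ do rewrite divff ?expf_neq0 // expr1n mulr1.
  by rewrite sumr_const card_ord normCK mulr_natl.
rewrite -mulr_sumr; set u := _ / _.
have un : u ^+ n = 1.
  by rewrite exprMn exprVn -!exprM ![(_ * n)%N]mulnC !exprM wn1 !expr1n divr1.
have u1 : u - 1 != 0.
  rewrite subr_eq0; apply: contra ii' => /eqP ui.
  have /eqP : w ^+ i = w ^+ i' by rewrite -[LHS](divfK (expf_neq0 i' w0)) -/u ui mul1r.
  by rewrite (eq_prim_root_expr wP) !modn_small // eq_sym.
have /eqP : (u - 1) * (\sum_(j < n) u ^+ j) = 0 by rewrite -subrX1 un subrr.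
by rewrite mulf_eq0 (negPf u1) => /eqP ->; rewrite mulr0.
Qed.

Section UnitCircle.
Variable R : realType.
Implicit Types (z : R[i]) (p q f : {poly R[i]}).

Lemma normr_normc z : `|z| = (normc z)%:C%C.
Proof. by case: z. Qed.

Lemma normc_ge0 z : 0 <= normc z.
Proof. by rewrite -ler0c -normr_normc normr_ge0. Qed.

Lemma normcX z n : normc (z ^+ n) = normc z ^+ n.
Proof. by elim: n => [|n IH]; rewrite ?expr0 ?normc1 // !exprS normcM IH. Qed.

Lemma normc_prod I (r : seq I) (F : I -> R[i]) :
  normc (\prod_(i <- r) F i) = \prod_(i <- r) normc (F i).
Proof. by apply: (big_morph _ (@normcM R) (normc1 R)). Qed.

Lemma normc_real (x : R) : 0 <= x -> normc x%:C%C = x.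
Proof. by move=> x0; apply/complexI; rewrite -normr_normc ger0_norm // ler0c. Qed.

Lemma parseval_normc n (w : R[i]) p :
  n.-primitive_root w -> (size p <= n)%N ->
  \sum_(j < n) normc p.[w ^+ j] ^+ 2 = n%:R * \sum_(i < n) normc p`_i ^+ 2.
Proof.
move=> wP szp; apply/complexI; rewrite rmorphM rmorph_nat !rmorph_sum /=.
under eq_bigr do rewrite rmorphXn /= -normr_normc.
under [in RHS]eq_bigr do rewrite rmorphXn /= -normr_normc.
exact: parseval_unity.
Qed.

Definition ek (k : R) : R[i] := (cos (2 * pi * k) +i* sin (2 * pi * k))%C.

Lemma ekD k l : ek (k + l) = ek k * ek l.
Proof.
rewrite /ek mulrDr cosD sinD; apply/eqP; rewrite eq_complex /= eqxx.
by rewrite addrC [cos _ * sin _]mulrC mulrC eqxx.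
Qed.

Lemma ek0 : ek 0 = 1.
Proof. by rewrite /ek mulr0 cos0 sin0. Qed.

Lemma ekX k n : ek k ^+ n = ek (n%:R * k).
Proof.
elim: n => [|n IH]; first by rewrite mul0r ek0.
by rewrite exprS IH -ekD -{1}[k]mul1r -mulrDl nat1r.
Qed.

Lemma normc_ek k : normc (ek k) = 1.
Proof. by rewrite /ek /= cos2Dsin2 sqrtr1. Qed.

Lemma ek_prim n : (0 < n)%N -> n.-primitive_root (ek n%:R^-1).
Proof.
move=> n_gt0; have n0 : n%:R != 0 :> R by rewrite pnatr_eq0 -lt0n.
have /prim_order_exists[//|m mP mn] : ek n%:R^-1 ^+ n = 1.
  by rewrite ekX mulfV // /ek mulr1 mulr_natl cos2pi sin2pi.
suff nm : n = m by rewrite [X in X.-primitive_root]nm.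
apply/eqP; rewrite eqn_leq (dvdn_leq n_gt0 mn) andbT leqNgt; apply/negP => ltmn.
have m_gt0 := prim_order_gt0 mP.
have := prim_expr_order mP; rewrite ekX => /(congr1 (@complex.Re R)) /=.
(* With x = pi m / n strictly between 0 and pi, cos(2x) = 1 - 2 sin(x)^2 cannot equal 1. *)
have -> : 2 * pi * (m%:R / n%:R) = (pi * (m%:R / n%:R)) *+ 2 :> R.
  by rewrite -mulrA mulr_natl.
rewrite cos_mulr2n cos2sin2 => E.
have : 0 < sin (pi * (m%:R / n%:R) : R).
  have pi0 := pi_gt0 R.
  apply: sin_gt0_pi; rewrite mulr_gt0 ?divr_gt0 ?ltr0n //=.
  by rewrite gtr_pMr // ltr_pdivrMr ?ltr0n // mul1r ltr_nat.
by move: E => /[swap] s0; rewrite mulr2n; nra.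
Qed.

(** By Parseval, the mean of |p|^2 over the n-th roots of unity, n > size p, is at least |p(0)|^2,
    so |p| reaches |p(0)| at one of these roots. *)
Lemma max_modulus p :
  exists2 k : R, 0 <= k <= 1 & normc p.[0] <= normc p.[ek k].
Proof.
set n := (size p).+1; have wP := ek_prim (isT : (0 < n)%N).
have [[j jP]|nj] := pselect (exists j : 'I_n, normc p.[0] <= normc p.[ek n%:R^-1 ^+ j]).
  exists (j%:R * n%:R^-1); last by rewrite -ekX.
  by rewrite divr_ge0 ?ler0n //= ler_pdivrMr ?ltr0n // mul1r ler_nat ltnW.
have lt_j j : (j < n)%N -> normc p.[ek n%:R^-1 ^+ j] ^+ 2 < normc p.[0] ^+ 2.
  move=> jn; rewrite ltr_pXn2r ?nnegrE ?normc_ge0 //.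
  by rewrite ltNge; apply/negP => h; apply: nj; exists (Ordinal jn).
suff : n%:R * normc p.[0] ^+ 2 < n%:R * normc p.[0] ^+ 2 by rewrite ltxx.
apply: (@le_lt_trans _ _ (\sum_(j < n) normc p.[ek n%:R^-1 ^+ j] ^+ 2)).
  rewrite (parseval_normc wP) ?leqnSn // ler_pM2l ?ltr0n //.
  rewrite (bigD1 ord0) //= horner_coef0 lerDl sumr_ge0 // => i _.
  by rewrite exprn_ge0 ?normc_ge0.
apply: (@lt_le_trans _ _ (\sum_(j < n) normc p.[0] ^+ 2)).
  apply: ltr_sum => [|j _]; last exact: lt_j.
  by apply/hasP; exists ord0 => //; rewrite mem_index_enum.
by rewrite sumr_const card_ord mulr_natl.
Qed.

Lemma golden_ratio_sqr : golden_ratio R ^+ 2 = golden_ratio R + 1.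
Proof.
have : Num.sqrt 5 ^+ 2 = 5 :> R by rewrite sqr_sqrtr.
by rewrite /golden_ratio; set s := Num.sqrt _ => s2; lra.
Qed.

Lemma golden_ratio_gt1 : 1 < golden_ratio R.
Proof.
rewrite /golden_ratio; suff : 1 < Num.sqrt 5 :> R by lra.
by rewrite -[X in X < _]sqrtr1 ltr_sqrt // ltr1n.
Qed.

(* Test f against 1 + v X^k with v = (golden_ratio - 1) f_k / |f_k|: the
   L2 norm of the product is at most M times that of 1 + v X^k. *)
Lemma golden_ratio_le_sup f (k : nat) (M : R) :
  (0 < k)%N -> f`_0 = 1 -> 1 <= normc f`_k ->
  (forall z, normc z = 1 -> normc f.[z] <= M) -> golden_ratio R <= M.
Proof.
move=> k_gt0 f0 fk fM.
set t := golden_ratio R - 1.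
have t0 : 0 < t by rewrite subr_gt0 golden_ratio_gt1.
have t2 : t ^+ 2 = 1 - t by rewrite /t; have := golden_ratio_sqr; lra.
have M0 : 0 <= M.
  by apply: le_trans (fM 1 (normc1 R)); apply: normc_ge0.
pose b : R := normc f`_k; have {}fk : 1 <= b by [].
have b0 : 0 < b by apply: lt_le_trans fk.
set v := (t / b)%:C%C * f`_k.
have nv : normc v = t.
  by rewrite normcM normc_real ?divr_ge0 ?ltW // divfK ?gt_eqF.
pose h : {poly R[i]} := 1 + v *: 'X^k.
set n := (size f + size h + k).+1.
have wP := ek_prim (isT : (0 < n)%N).
have h0 : h`_0 = 1 by rewrite coefD coef1 coefZ coefXn /= ltn_eqF // mulr0 addr0.
have hk : h`_k = v by rewrite coefD coef1 coefZ coefXn eqxx gtn_eqF //= add0r mulr1.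
have hi i : i != 0%N -> i != k -> h`_i = 0.
  by move=> /negPf i0 /negPf ik; rewrite coefD coef1 coefZ coefXn i0 ik mulr0 addr0.
have k_lt : (k < n)%N by rewrite /n ltnS leq_addl.
have szh : (size h <= n)%N by rewrite /n; lia.
have szfh : (size (f * h)%R <= n)%N.
  by apply: leq_trans (size_polyMleq _ _) _; rewrite /n; lia.
pose ik := Ordinal k_lt.
have ik0 : ik != ord0 by rewrite -val_eqE /= -lt0n.
have Sh : \sum_(i < n) normc h`_i ^+ 2 = 1 + t ^+ 2.
  rewrite (bigD1 ord0) //= (bigD1 ik) //= h0 hk normc1 expr1n nv big1 ?addr0 //.
  move=> i /andP[i0 ii]; rewrite hi ?normc0 ?expr0n //.
have fh0 : (f * h)`_0 = 1 by rewrite coef0M f0 h0 mulr1.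
have fhk : (f * h)`_k = f`_k + v.
  by rewrite mulrDr mulr1 -scalerAr coefD coefZ coefMXn ltnn subnn f0 mulr1.
have nfhk : normc (f * h)`_k = b + t.
  have -> : (f * h)`_k = (1 + t / b)%:C%C * f`_k.
    by rewrite fhk rmorphD rmorph1 mulrDl mul1r.
  rewrite normcM normc_real ?addr_ge0 ?divr_ge0 ?ltW // -/b.
  by rewrite mulrDl mul1r divfK ?gt_eqF.
have Sfh : 1 + (b + t) ^+ 2 <= \sum_(i < n) normc (f * h)`_i ^+ 2.
  rewrite (bigD1 ord0) //= (bigD1 ik) //= fh0 nfhk normc1 expr1n lerD2l lerDl.
  by apply: sumr_ge0 => i _; rewrite exprn_ge0 ?normc_ge0.
have key : 1 + (b + t) ^+ 2 <= M ^+ 2 * (1 + t ^+ 2).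
  rewrite -(ler_pM2l (ltr0Sn R n.-1)) -Sh mulrCA -(parseval_normc wP szh).
  apply: le_trans (_ : n%:R * \sum_(i < n) normc (f * h)`_i ^+ 2 <= _).
    by rewrite ler_pM2l ?ltr0n.
  rewrite -(parseval_normc wP szfh) mulr_sumr; apply: ler_sum => j _.
  rewrite hornerM normcM exprMn ler_pM ?exprn_ge0 ?normc_ge0 //.
  by rewrite lerXn2r ?nnegrE ?normc_ge0 // fM // normcX normc_ek expr1n.
have : (1 + t) ^+ 2 <= M ^+ 2.
  have b2 : (1 + t) ^+ 2 <= (b + t) ^+ 2 by apply: lerXn2r; rewrite ?nnegrE; lra.
  rewrite -(ler_pM2r (_ : 0 < 1 + t ^+ 2)); last by nra.
  apply: le_trans key; rewrite t2.
  (* This amounts to (1 + t)^2 (1 - t) = 1, a consequence of t^2 = 1 - t; it is what makes the bound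
     come out as exactly 1 + t. *)
  have -> : (1 + t) ^+ 2 * (1 + (1 - t)) = 1 + (1 + t) ^+ 2 by ring: t2.
  lra.
have -> : golden_ratio R = 1 + t by rewrite /t; lra.
by rewrite ler_pXn2r // nnegrE addr_ge0 // ltW.
Qed.
End UnitCircle.

(** * Outer polynomials *)

Section Outer.
Variable R : realType.
Implicit Types (z w : R[i]) (p q f F : {poly R[i]}).

Lemma normc_sqr z : normc z ^+ 2 = complex.Re z ^+ 2 + complex.Im z ^+ 2.
Proof. by case: z => a b; rewrite sqr_sqrtr // addr_ge0 ?sqr_ge0. Qed.

(** After squaring, the difference of the two sides is (1 - r)^2 |1 + w|^2 + 2 (1 - r^2) (1 -
    |w|^2), a sum of nonnegative terms. *)
Lemma normc_1Bscale (r : R) w : 0 <= r <= 1 -> normc w <= 1 ->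
  (1 + r) * normc (1 - w) <= 2 * normc (1 - r%:C%C * w).
Proof.
move=> /andP[r0 r1] w1.
rewrite -(@ler_pXn2r _ 2) ?nnegrE ?mulr_ge0 ?addr_ge0 ?normc_ge0 //.
have : normc w ^+ 2 <= 1 by rewrite expr_le1 ?normc_ge0.
rewrite !exprMn !normc_sqr; case: w w1 => a b _ /= ab.
rewrite -subr_ge0.
have -> : 2 ^+ 2 * ((1 - (r * a - 0 * b)) ^+ 2 + (0 - (r * b + 0 * a)) ^+ 2) -
    (1 + r) ^+ 2 * ((1 - a) ^+ 2 + (0 - b) ^+ 2)
  = (1 - r) ^+ 2 * ((1 + a) ^+ 2 + b ^+ 2) +
    2 * (1 - r ^+ 2) * (1 - (a ^+ 2 + b ^+ 2)) by ring.
have r2 : 0 <= 1 - r ^+ 2 by rewrite subr_ge0 expr_le1.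
have ab2 : 0 <= 1 - (a ^+ 2 + b ^+ 2) by rewrite subr_ge0.
apply: addr_ge0; first by rewrite mulr_ge0 ?sqr_ge0 // addr_ge0 ?sqr_ge0.
by rewrite !mulr_ge0.
Qed.

(* q is the truncation of the geometric series of 1 / (1 - r b X), r < 1. *)
Lemma linear_approx_inverse (b : R[i]) (c : R) : normc b <= 1 -> 1 < c ->
  exists2 q, q.[0] = 1 & forall z, normc z = 1 -> normc ((1 - b * z) * q.[z]) <= c.
Proof.
move=> b1 c1; have c0 : 0 < c by apply: lt_trans c1.
have [n cn] : exists n : nat, 2 / (c - 1) <= c ^+ n.
  exists (Num.bound (2 / (c - 1) / (c - 1))).
  (* Bernoulli's inequality c^N >= 1 + N (c - 1), where N (c - 1) >= 2 / (c - 1). *)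
  set N := Num.bound _; apply: (@le_trans _ _ (1 + N%:R * (c - 1))).
    have /archi_boundP : 0 <= 2 / (c - 1) / (c - 1) by rewrite !divr_ge0 ?subr_ge0 ?ltW.
    rewrite -/N ltr_pdivrMr ?subr_gt0 // => /ltW h.
    by apply: le_trans h _; rewrite lerDr.
  elim: N => [|N IH]; first by rewrite mul0r addr0 expr0.
  rewrite exprS -natr1.
  have := ler_wpM2l (ltW c0) IH.
  have : 0 <= N%:R * (c - 1) ^+ 2 by rewrite mulr_ge0 ?sqr_ge0.
  lra.
(* Then (1 + r) c = c + 1, so the final estimate 2 (1 + r^n) <= (1 + r) c asks exactly for r^n <= (c
   - 1) / 2, which dictated the choice of n. *)
pose r := c^-1.
have r01 : 0 <= r <= 1 by rewrite invr_ge0 ltW //= invf_le1 // ltW.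
have rc : r * c = 1 by rewrite mulVf ?gt_eqF.
have rn : r ^+ n <= (c - 1) / 2.
  rewrite exprVn -[leRHS]invrK lef_pV2 ?posrE ?invr_gt0 ?exprn_gt0 //.
    by rewrite invf_div.
  by rewrite divr_gt0 ?subr_gt0.
exists (\poly_(i < n.+1) (r%:C%C * b) ^+ i).
  by rewrite horner_coef0 coef_poly expr0.
move=> z z1; rewrite horner_poly.
under eq_bigr do rewrite -exprMn -mulrA.
set w := b * z; have w1 : normc w <= 1 by rewrite normcM z1 mulr1.
set S := \sum_(i < _) _.
have SE : (1 - r%:C%C * w) * S = 1 - (r%:C%C * w) ^+ n.+1.
  by rewrite -[RHS]opprB subrX1 -[in RHS]mulNr opprB.
have rw0 : 0 <= r by case/andP: r01.
have : (1 + r) * normc ((1 - w) * S) <= 2 * (1 + r ^+ n).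
  rewrite normcM mulrA; apply: le_trans (ler_wpM2r (normc_ge0 S) (normc_1Bscale r01 w1)) _.
  rewrite -mulrA -normcM SE ler_pM2l // (le_trans (le_normcD _ _)) // normc1 normcN lerD2l.
  rewrite normcX normcM normc_real //.
  rewrite exprMn; apply: (@le_trans _ _ (r ^+ n.+1)).
    by rewrite ler_piMr ?exprn_ge0 // expr_le1 // normc_ge0.
  by rewrite exprS ler_piMl ?exprn_ge0 //; case/andP: r01.
move=> h; have r1 : 0 < 1 + r by rewrite ltr_pwDl.
rewrite -(ler_pM2l r1); apply: (le_trans h).
lra.
Qed.

(* F behaves like an outer function: 1/F is approximated on the unit circle by
   polynomials, up to a factor that is nearly constant in modulus. *)
Definition quasi_outer F := forall c : R, 1 < c ->
  exists2 q, q.[0] = 1 &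
    forall z, normc z = 1 -> normc (F.[z] * q.[z]) <= c * normc F.[0].

Lemma quasi_outerM F G : quasi_outer F -> quasi_outer G -> quasi_outer (F * G).
Proof.
move=> oF oG c c1.
have s1 : 1 < Num.sqrt c by rewrite -[X in X < _]sqrtr1 ltr_sqrt // (lt_trans _ c1).
have [p p0 pF] := oF _ s1; have [q q0 qG] := oG _ s1.
exists (p * q) => [|z z1]; first by rewrite hornerM p0 q0 mulr1.
have -> : c = Num.sqrt c * Num.sqrt c by rewrite -expr2 sqr_sqrtr // ltW // (lt_trans _ c1).
rewrite !hornerM mulrACA normcM [normc (_.[0] * _)]normcM [leRHS]mulrACA.
by rewrite ler_pM ?normc_ge0 ?pF ?qG.
Qed.

Lemma quasi_outerC (a : R[i]) : quasi_outer a%:P.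
Proof.
move=> c c1; exists 1 => [|z _]; first by rewrite hornerE.
by rewrite !hornerE ler_peMl ?normc_ge0 ?ltW.
Qed.

Lemma quasi_outer_linear (b : R[i]) : normc b <= 1 -> quasi_outer (1 - b *: 'X).
Proof.
move=> b1 c c1; have [q q0 qb] := linear_approx_inverse b1 c1.
by exists q => // z z1; rewrite !hornerE subr0 normc1 mulr1 qb.
Qed.

Lemma normc_conj z : normc z^*%C = normc z.
Proof. by case: z => a b /=; rewrite sqrrN. Qed.

Lemma mulc_conj_unit z : normc z = 1 -> z * z^*%C = 1.
Proof. by move=> z1; rewrite -sqr_normc normr_normc z1 expr1n. Qed.

(** A root of modulus at most 1 is reflected, since |z - a| = |1 - conj(a) z| on the circle;
    otherwise z - a = -a (1 - z / a) already has the required form. *)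
Lemma quasi_outer_XsubC (a : R[i]) : exists2 F, quasi_outer F &
  forall z, normc z = 1 -> normc F.[z] = normc (z - a).
Proof.
have [a1|a1] := leP (normc a) 1.
  exists (1 - a^*%C *: 'X) => [|z z1].
    by apply: quasi_outer_linear; rewrite normc_conj.
  rewrite !hornerE -normc_conj rmorphB rmorphM rmorph1 /= conjcK.
  by rewrite -[LHS]mul1r -{1}z1 -normcM mulrBr mulr1 mulrCA mulc_conj_unit // mulr1.
have a0 : a != 0 by apply: contraTneq a1 => ->; rewrite normc0 ltr10.
exists ((- a)%:P * (1 - a^-1 *: 'X)) => [|z z1].
  apply/quasi_outerM; first exact: quasi_outerC.
  by apply: quasi_outer_linear; rewrite normcV invf_le1 ?ltW // (lt_trans _ a1).
by rewrite !hornerE mulrBr mulr1 mulNr mulVKf // opprK addrC.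
Qed.

Lemma quasi_outer_exists p : exists2 F, quasi_outer F &
  forall z, normc z = 1 -> normc F.[z] = normc p.[z].
Proof.
have [s ->] := closed_field_poly_normal p.
suff [F oF FE] : exists2 F, quasi_outer F & forall z, normc z = 1 ->
    normc F.[z] = normc (\prod_(a <- s) ('X - a%:P)).[z].
  exists ((lead_coef p)%:P * F) => [|z z1].
    by apply: quasi_outerM => //; apply: quasi_outerC.
  by rewrite mul_polyC !hornerZ !normcM FE.
elim: s => [|a s [F oF FE]].
  by exists 1%:P => [|z _]; [apply: quasi_outerC|rewrite big_nil].
have [G oG GE] := quasi_outer_XsubC a.
exists (G * F) => [|z z1]; first exact: quasi_outerM.
by rewrite big_cons !hornerM !normcM FE // GE // !hornerE.
Qed.

End Outer.

(** * Polynomials with coefficients +1 and -1, and the golden ratio bound *)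

Section Littlewood.
Variable R : realType.
Implicit Types (z w : R[i]) (p q f F : {poly R[i]}).

Definition littlewood (L : nat) (c : nat -> bool) : {poly R[i]} :=
  \poly_(i < L) (-1) ^+ c i.

(** The coefficients are real and conj(z) = 1 / z on the circle, so reversing them conjugates the
    value and multiplies it by a power of z. *)
Lemma normc_littlewood_rev L c z : normc z = 1 ->
  normc (littlewood L (fun i => c (L.-1 - i)%N)).[z] = normc (littlewood L c).[z].
Proof.
case: L => [|L] z1; first by rewrite /littlewood !poly_def !big_ord0.
have -> : (littlewood L.+1 (fun i => c (L - i)%N)).[z]
    = z ^+ L * ((littlewood L.+1 c).[z])^*%C.
  rewrite !horner_poly rmorph_sum mulr_sumr (reindex_inj rev_ord_inj).
  apply: eq_bigr => i _ /=; have iL : (i <= L)%N by rewrite -ltnS.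
  rewrite rmorphM !rmorphXn rmorphN1 mulrCA subSS subKn //; congr (_ * _).
  rewrite -[X in _ = z ^+ X * _](subnK iL) exprD -mulrA -exprMn.
  by rewrite mulc_conj_unit // expr1n mulr1.
by rewrite normcM normcX z1 expr1n mul1r normc_conj.
Qed.

Lemma littlewood_sup_ge L c q (M : R) :
  ~ (forall i, (i < L)%N -> c (L.-1 - i)%N = c i) ->
  ~ (forall i, (i < L)%N -> c (L.-1 - i)%N = ~~ c i) ->
  q.[0] = 1 ->
  (forall z, normc z = 1 -> normc ((littlewood L c).[z] * q.[z]) <= M) ->
  golden_ratio R <= M.
Proof.
move=> npal napal q0 qM.
pose c' i := c (L.-1 - i)%N.
(* [d b i] is the sign bit of coefficient i after normalizing the constant coefficient to 1. *)
pose d (b : nat -> bool) i := b 0%N (+) b i.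
have L_gt0 : (0 < L)%N by case: (L) npal => // npal; case: npal.
have exk : exists k, (k < L)%N && (d c k != d c' k).
  apply: contrapT => nk.
  (* If the normalized sequences agreed everywhere, the reversal of c would be c up to one global
     sign, the two cases excluded by hypothesis. *)
  have E k : (k < L)%N -> c (L.-1 - k)%N = c 0%N (+) c L.-1 (+) c k.
    move=> kL; apply: contrapT => h; apply: nk; exists k; rewrite kL /=.
    apply/eqP => dE; apply: h; move: dE; rewrite /d /c' subn0.
    by case: (c 0%N); case: (c L.-1); case: (c k); case: (c (L.-1 - k)%N).
  case cc : (c 0%N (+) c L.-1).
    by apply: napal => i iL; rewrite E // cc.
  by apply: npal => i iL; rewrite E // cc.
case: (ex_minnP exk) => {exk}k /andP[kL dk] kmin.
have k_gt0 : (0 < k)%N by case: k dk {kL kmin} => //; rewrite /d !addbb.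
pose f (b : nat -> bool) := (-1) ^+ b 0%N *: littlewood L b.
have f_coef b i : (i < L)%N -> (f b)`_i = (-1) ^+ d b i.
  by move=> iL; rewrite coefZ coef_poly iL signr_addb.
have f0 b : (f b * q)`_0 = 1.
  by rewrite coef0M f_coef // /d addbb expr0 mul1r -horner_coef0.
have fM b :
    (forall z, normc z = 1 ->
      normc (littlewood L b).[z] = normc (littlewood L c).[z]) ->
    forall z, normc z = 1 -> normc (f b * q).[z] <= M.
  move=> bc z z1; rewrite hornerM hornerZ -mulrA normcM normcX normcN normc1 expr1n mul1r.
  by rewrite normcM bc // -normcM qM.
(* Since k is the first index where the normalized coefficients differ, only the term with q(0) = 1
   survives in the convolution. *)
have fk : (f c * q)`_k - (f c' * q)`_k = (-1) ^+ d c k *+ 2.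
  rewrite -coefB -mulrBl coefM big_ord_recr /= big1 ?add0r => [|i _].
    rewrite subnn -horner_coef0 q0 mulr1 coefB !f_coef //.
    move: dk; case: (d c k); case: (d c' k) => //= _; rewrite ?expr0 ?expr1.
    by rewrite opprK.
  rewrite coefB !f_coef ?(ltn_trans _ kL) //.
  suff -> : d c i = d c' i by rewrite subrr mul0r.
  apply/eqP; apply: contraT => di.
  by have := kmin i; rewrite (ltn_trans _ kL) // di leqNgt ltn_ord => /(_ isT).
have [h|h] := leP 1 (normc (f c * q)`_k).
  by apply: (golden_ratio_le_sup k_gt0 _ h) => //; apply: fM.
have [h'|h'] := leP 1 (normc (f c' * q)`_k).
  apply: (golden_ratio_le_sup k_gt0 _ h') => //; apply: fM => z.
  exact: normc_littlewood_rev.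
(* Two numbers of modulus below 1 cannot be at distance 2. *)
have := le_normcD (f c * q)`_k (- (f c' * q)`_k).
rewrite fk normcMn normcX !normcN normc1 expr1n mulr2n => h2.
by have := le_lt_trans h2 (ltrD h h'); rewrite ltxx.
Qed.

Lemma littlewood_outer_part L c :
  ~ (forall i, (i < L)%N -> c (L.-1 - i)%N = c i) ->
  ~ (forall i, (i < L)%N -> c (L.-1 - i)%N = ~~ c i) ->
  exists2 F : {poly R[i]}, golden_ratio R <= normc F.[0] &
    forall z, normc z = 1 -> normc F.[z] = normc (littlewood L c).[z].
Proof.
move=> npal napal; have [F oF FE] := quasi_outer_exists (littlewood L c).
exists F => //; apply/ler_addgt0Pr => e e0.
have F0 := normc_ge0 F.[0].
(* The added 1 keeps the denominator positive even if F(0) = 0, and the error e |F(0)| / (|F(0)| +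
   1) is still at most e. *)
have e1 : 0 < normc F.[0] + 1 by rewrite ltr_wpDl.
have c1 : 1 < 1 + e / (normc F.[0] + 1) by rewrite ltrDl divr_gt0.
have [q q0 qF] := oF _ c1.
have : golden_ratio R <= (1 + e / (normc F.[0] + 1)) * normc F.[0].
  by apply: (littlewood_sup_ge npal napal q0) => z z1; rewrite normcM -FE // -normcM qF.
move=> /le_trans; apply.
rewrite mulrDl mul1r lerD2l mulrAC ler_pdivrMr // ler_pM2l // lerDl //.
Qed.
End Littlewood.

(** * Lipschitz functions and Riemann sums *)

Section Analysis.
Variable R : realType.
Notation mu := (@lebesgue_measure R).

Definition lipschitz_fun (f : R -> R) :=
  exists2 K, 0 <= K & forall x y, `|f x - f y| <= K * `|x - y|.

Lemma lipschitz_fun_continuous f : lipschitz_fun f -> continuous f.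
Proof.
move=> [K K0 fK] x; apply/cvgrPdist_le => e e0.
have K1 : 0 < K + 1 by rewrite ltr_wpDl.
near=> y; apply: le_trans (fK x y) _.
apply: (@le_trans _ _ ((K + 1) * (e / (K + 1)))); last by rewrite mulrCA mulfV ?mulr1 ?gt_eqF.
apply: ler_pM => //; first by rewrite lerDl.
by near: y; apply: cvgr_dist_le => //; rewrite divr_gt0.
Unshelve. all: by end_near. Qed.

Lemma continuous_itv_integrable (f : R -> R) (i : interval R) a b : continuous f ->
  [set` i] `<=` `[a, b] ->
  mu.-integrable [set` i] (EFin \o f).
Proof.
move=> cf ib; apply: (@integrableS _ _ _ mu `[a, b]) => //.
apply: continuous_compact_integrable; first exact: segment_compact.
exact: continuous_subspaceT.
Qed.

Lemma Rintegral_ge_sum (f : R -> R) (a h : R) (c : nat -> R) n : continuous f -> 0 < h ->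
  (forall j x, a + j%:R * h <= x <= a + j.+1%:R * h -> c j <= f x) ->
  h * \sum_(j < n) c j <= \int[mu]_(x in `[a, a + n%:R * h]) f x.
Proof.
move=> cf h0 cP; elim: n => [|n IH].
  by rewrite big_ord0 mulr0 mul0r addr0 set_itv1 Rintegral_set1.
have ah : a <= a + n%:R * h by rewrite lerDl mulr_ge0 // ltW.
have nn : a + n%:R * h <= a + n.+1%:R * h by rewrite lerD2l ler_wpM2r ?ler_nat // ltW.
have ci (i : interval R) : ([set` i] `<=` `[a, a + n.+1%:R * h]) ->
    mu.-integrable [set` i] (EFin \o f) by apply: continuous_itv_integrable.
rewrite big_ord_recr /= mulrDr -lerBrDl.
have -> : h * c n = \int[mu]_(x in `]a + n%:R * h, a + n.+1%:R * h]) c n.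
  rewrite Rintegral_cst // /= lebesgue_measure_itv /= lte_fin.
  by rewrite ltrD2l ltr_pM2r // ltr_nat ltnSn /= -natr1; ring.
apply: (@le_trans _ _ (\int[mu]_(x in `]a + n%:R * h, a + n.+1%:R * h]) f x)).
  apply: le_Rintegral => //.
  - apply: (@continuous_itv_integrable _ _ (a + n%:R * h) (a + n.+1%:R * h)).
      exact: cst_continuous.
    by apply: subset_itvr; rewrite bnd_simp.
  - by apply: ci; apply: subset_itvr; rewrite bnd_simp.
  - by move=> x /=; rewrite in_itv /= => /andP[h1 h2]; apply: cP; rewrite ltW.
rewrite -(@Rintegral_itvB _ f (BLeft a) (BRight (a + n.+1%:R * h)) (a + n%:R * h)).
- by rewrite lerB.
- by apply: ci.
- by rewrite bnd_simp.
- by rewrite bnd_simp.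
Qed.

(** The starting point k of the sampling may change with n, but [k, k + 1] always lies in [0, 2];
    nonnegativity of f allows passing to the larger interval. *)
Lemma integral_ge_riemann_sum (f : R -> R) (d : R) :
  lipschitz_fun f -> (forall x, 0 <= f x) ->
  (forall n, (0 < n)%N -> exists2 k, 0 <= k <= 1 &
     n%:R * d <= \sum_(j < n) f (k + j%:R * n%:R^-1)) ->
  d <= \int[mu]_(x in `[0, 2]) f x.
Proof.
move=> lf f0 fd; have cf := lipschitz_fun_continuous lf.
have [K K0 fK] := lf.
apply/ler_addgt0Pr => e e0.
(* This n makes the oscillation of f on a cell, at most K / n, smaller than or equal to e. *)
pose n := (Num.bound (K / e)).+1.
have n0 : 0 < n%:R :> R by rewrite ltr0n.
have Kn : K / n%:R <= e.
  rewrite ler_pdivrMr // mulrC -ler_pdivrMr //.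
  have /archi_boundP : 0 <= K / e by rewrite divr_ge0 // ltW.
  by move/ltW/le_trans; apply; rewrite ler_nat.
have [k /andP[k0 k1] kd] := fd n isT.
have : n%:R^-1 * \sum_(j < n) (f (k + j%:R * n%:R^-1) - K / n%:R) <=
    \int[mu]_(x in `[k, k + n%:R * n%:R^-1]) f x.
  apply: (@Rintegral_ge_sum f k n%:R^-1 (fun j => f (k + j%:R * n%:R^-1) - K / n%:R)) => //.
    by rewrite invr_gt0.
  move=> j x /andP[jx xj]; rewrite lerBlDl -lerBlDr.
  apply: le_trans (ler_norm _) _; rewrite distrC; apply: (le_trans (fK _ _)).
  rewrite ler_wpM2l // ger0_norm ?subr_ge0 //.
  by rewrite lerBlDr; apply: le_trans xj _; rewrite -[j.+1%:R]natr1 mulrDl mul1r; lra.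
rewrite big_split /= sumr_const card_ord mulrDr mulfV ?gt_eqF // => h1.
have h2 : \int[mu]_(x in `[k, k + 1]) f x <= \int[mu]_(x in `[0, 2]) f x.
  have sub : `[k, k + 1] `<=` `[0, 2].
    by move=> x /=; rewrite !in_itv /= => /andP[kx xk]; apply/andP; split; lra.
  apply: fine_le.
  - by apply: integrable_fin_num => //; apply: continuous_itv_integrable sub.
  - by apply: integrable_fin_num => //; apply: (@continuous_itv_integrable _ _ 0 2).
  - apply: ge0_subset_integral => //; last by move=> x _; rewrite lee_fin.
    apply/measurable_EFinP; apply: measurable_funTS.
    exact: continuous_measurable_fun.
have h3 : d <= n%:R^-1 * \sum_(j < n) f (k + j%:R * n%:R^-1).
  by rewrite -(ler_pM2l n0) mulVKf // gt_eqF.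
have : n%:R^-1 * (- (K / n%:R) *+ n) = - (K / n%:R).
  by rewrite -[X in _ * X = _]mulr_natl mulKf // gt_eqF.
move: h1 => /[swap] -> /le_trans/(_ h2); lra.
Qed.

Lemma lipschitz_fun_comp (f g : R -> R) : lipschitz_fun f -> lipschitz_fun g ->
  lipschitz_fun (g \o f).
Proof.
move=> [K K0 fK] [M M0 gM]; exists (M * K) => [|x y]; first exact: mulr_ge0.
by rewrite /= (le_trans (gM _ _)) // -mulrA ler_wpM2l.
Qed.

Lemma lipschitz_fun_MVT (f f' : R -> R) (K : R) :
  (forall x : R, is_derive x 1 f (f' x)) -> (forall x, `|f' x| <= K) -> lipschitz_fun f.
Proof.
move=> df fK; exists K => [|x y]; first exact: le_trans (fK 0).
wlog yx : x y / y <= x => [H|].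
  by case: (leP y x) => [/H//|/ltW/H]; rewrite distrC [`|y - x|]distrC.
have [|c _ ->] := @MVT_segment R f f' y x yx.
- apply: continuous_subspaceT => z; apply: differentiable_continuous.
  by apply/derivable1_diffP; have [] := df z.
- by rewrite normrM ler_wpM2r.
Qed.

Lemma sin_lipschitz : lipschitz_fun (@sin R).
Proof.
apply: (@lipschitz_fun_MVT _ cos 1) => x; rewrite ler_norml.
by rewrite cos_geN1 cos_le1.
Qed.

Lemma cos_lipschitz : lipschitz_fun (@cos R).
Proof.
apply: (@lipschitz_fun_MVT _ (fun x => - sin x) 1) => x; rewrite normrN ler_norml.
by rewrite sin_geN1 sin_le1.
Qed.

(** For M >= m >= 1, ln (M / m) <= M / m - 1 = (M - m) / m <= M - m. *)
Lemma ln_max1_lipschitz : lipschitz_fun (fun x : R => ln (Num.max 1 x)).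
Proof.
exists 1 => // x y; rewrite mul1r.
wlog yx : x y / y <= x => [H|].
  by case: (leP y x) => [/H//|/ltW/H]; rewrite distrC [`|y - x|]distrC.
have my : 1 <= Num.max 1 y by rewrite le_max lexx.
have mx : 1 <= Num.max 1 x by rewrite le_max lexx.
have mxy : Num.max 1 y <= Num.max 1 x by rewrite ge_max !le_max lexx yx orbT.
have m0 : 0 < Num.max 1 y by apply: lt_le_trans my.
have m0' : 0 < Num.max 1 x by apply: lt_le_trans mx.
rewrite !ger0_norm ?subr_ge0 ?ler_ln ?posrE // -ln_div ?posrE //.
set M := Num.max 1 x in mx mxy m0' *; set m := Num.max 1 y in my mxy m0 *.
have Mm0 : 0 < M / m by rewrite divr_gt0.
have := @le_ln1Dx R (M / m - 1); rewrite [1 + _]addrC subrK => /(_ _)/le_trans; apply.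
  by rewrite ltrBrDr addNr.
apply: (@le_trans _ _ (M - m)).
  have -> : M / m - 1 = (M - m) / m by rewrite mulrBl divff ?gt_eqF.
  by rewrite ler_pdivrMr // ler_peMr // subr_ge0.
by rewrite /M /m; case: (leP 1 x) => ?; case: (leP 1 y) => ?; lra.
Qed.
End Analysis.

(** * Jensen's inequality for log max(1, |H|) *)

Section LogPlus.
Variable R : realType.
Implicit Types (z : R[i]) (H : {poly R[i]}).

(** This is log^+; truncating inside the logarithm removes the singularity at zeros and gives a
    Lipschitz function. *)
Definition lnp (x : R) : R := ln (Num.max 1 x).

Lemma max1_gt0 (x : R) : 0 < Num.max 1 x.
Proof. by apply: (@lt_le_trans _ _ 1); rewrite ?ltr01 // le_max lexx. Qed.

Lemma lnp_le (x y : R) : 1 <= y -> x <= y -> lnp x <= ln y.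
Proof.
move=> y1 xy; rewrite /lnp ler_ln ?posrE ?max1_gt0 //; last exact: lt_le_trans y1.
by rewrite ge_max y1.
Qed.

(* Apply the maximum modulus principle to prod_j H(e(j/n) X), whose value at 0
   is H(0)^n. *)
Lemma sum_lnp_ge H n : 0 < normc H.[0] -> (0 < n)%N ->
  exists2 k, 0 <= k <= 1 &
    n%:R * ln (normc H.[0]) <= \sum_(j < n) lnp (normc H.[ek (k + j%:R * n%:R^-1)]).
Proof.
move=> H0 n0.
pose G := \prod_(j < n) (H \Po (ek (j%:R * n%:R^-1) *: 'X)).
have GE z : normc G.[z] = \prod_(j < n) normc H.[ek (j%:R * n%:R^-1) * z].
  rewrite horner_prod normc_prod; apply: eq_bigr => j _.
  by rewrite horner_comp hornerZ hornerX.
have [k k01 Gk] := max_modulus G; exists k => //.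
rewrite -ler_expR expRM_natl lnK // expR_sum.
have <- : normc G.[0] = normc H.[0] ^+ n.
  rewrite GE -[in RHS](card_ord n) -prodr_const.
  by apply: eq_bigr => j _; rewrite mulr0.
apply: (le_trans Gk); rewrite GE; apply: ler_prod => j _.
rewrite normc_ge0 /= lnK ?posrE ?max1_gt0 //.
by rewrite addrC ekD le_max lexx orbT.
Qed.

Lemma dist_normc (z w : R[i]) : `|normc z - normc w| <= normc (z - w).
Proof.
have h x y : normc x - normc y <= normc (x - y).
  by rewrite lerBlDr -{1}(subrK y x) le_normcD.
by rewrite ler_norml h andbT lerNl opprB -[normc (z - w)]normcN opprB h.
Qed.

Lemma horner_circle_lipschitz H : exists2 K : R, 0 <= K &
  forall z w, normc z = 1 -> normc w = 1 -> normc (H.[z] - H.[w]) <= K * normc (z - w).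
Proof.
elim/poly_ind: H => [|H c [K K0 HK]].
  by exists 0 => // z w _ _; rewrite !hornerC subr0 normc0 mul0r.
(* The constant comes from the product rule for H X + c, with |H(w)| <= |H(1)| + K |w - 1| and |w -
   1| <= 2. *)
exists (K + (normc H.[1] + K * 2)) => [|z w z1 w1].
  by rewrite !addr_ge0 ?mulr_ge0 ?normc_ge0.
rewrite !hornerD !hornerM !hornerX !hornerC.
have -> : H.[z] * z + c - (H.[w] * w + c) = (H.[z] - H.[w]) * z + H.[w] * (z - w) by ring.
apply: le_trans (le_normcD _ _) _; rewrite !normcM z1 mulr1 mulrDl lerD //; first exact: HK.
rewrite ler_wpM2r ?normc_ge0 //.
have -> : H.[w] = H.[1] + (H.[w] - H.[1]) by ring.
apply: le_trans (le_normcD _ _) _; rewrite lerD2l.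
apply: le_trans (HK _ _ w1 (normc1 R)) _; rewrite ler_wpM2l //.
by apply: le_trans (le_normcD _ _) _; rewrite normcN w1 normc1.
Qed.

Lemma normc_le_ReIm (a b : R) : normc (a +i* b)%C <= `|a| + `|b|.
Proof.
rewrite -(ler_pXn2r (_ : 0 < 2)%N) ?nnegrE ?normc_ge0 ?addr_ge0 //.
rewrite normc_sqr /= sqrrD !real_normK ?num_real // lerD2r lerDl.
by rewrite mulrn_wge0 ?mulr_ge0.
Qed.

Lemma ek_lipschitz : exists2 K : R, 0 <= K &
  forall k l : R, normc (ek k - ek l) <= K * `|k - l|.
Proof.
have [K K0 KP] := sin_lipschitz R; have [M M0 MP] := cos_lipschitz R.
have pi0 : 0 <= 2 * pi :> R by rewrite mulr_ge0 ?pi_ge0.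
exists ((M + K) * (2 * pi)) => [|k l]; first by rewrite mulr_ge0 ?addr_ge0.
apply: le_trans (normc_le_ReIm _ _) _.
have E : `|2 * pi * k - 2 * pi * l| = 2 * pi * `|k - l|.
  by rewrite -mulrBr normrM ger0_norm.
have := MP (2 * pi * k) (2 * pi * l); have := KP (2 * pi * k) (2 * pi * l).
rewrite E => h1 h2.
have -> : (M + K) * (2 * pi) * `|k - l| =
  M * (2 * pi * `|k - l|) + K * (2 * pi * `|k - l|) by ring.
exact: lerD.
Qed.

Lemma lnp_horner_lipschitz H : lipschitz_fun (fun k => lnp (normc H.[ek k])).
Proof.
apply: (@lipschitz_fun_comp R (fun k => normc H.[ek k]) lnp); last exact: ln_max1_lipschitz.
have [K K0 HK] := horner_circle_lipschitz H; have [M M0 eM] := ek_lipschitz.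
exists (K * M) => [|x y]; first exact: mulr_ge0.
apply: le_trans (dist_normc _ _) _.
by rewrite (le_trans (HK _ _ (normc_ek _) (normc_ek _))) // -mulrA ler_wpM2l.
Qed.

End LogPlus.

(** * Lower bounds for an arbitrary norm on 2 x 2 complex matrices *)

Section MatrixNorm.
Variables (R : realType) (N : 'M[R[i]]_2 -> R).
Hypothesis N_norm : is_mx_norm N.

Lemma mx_normN A : N (- A) = N A.
Proof. by case: N_norm => _ NZ _; rewrite -scaleN1r NZ normcN normc1 mul1r. Qed.

Lemma mx_norm0 : N 0 = 0.
Proof. by case: N_norm => _ NZ _; rewrite -(scale0r 0) NZ normc0 mul0r. Qed.

Lemma mx_norm_ge0 A : 0 <= N A.
Proof.
case: N_norm => _ _ ND; have := ND A (- A); rewrite subrr mx_norm0 mx_normN; lra.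
Qed.

(** Pairwise intersecting closed intervals of the line have a common point: the supremum of their
    left endpoints. *)
Lemma common_point (u d : nat -> R) : (forall n m, u n - d n <= u m + d m) ->
  exists a, forall n, `|a - u n| <= d n.
Proof.
move=> ud; pose S := range (fun n => u n - d n).
have S0 : S !=set0 by exists (u 0%N - d 0%N); exists 0%N.
have Sub m : ubound S (u m + d m) by move=> _ [n _ <-].
exists (sup S) => n; rewrite ler_norml lerBrDr lerBlDr addrC; apply/andP; split.
  by apply: ub_le_sup; [exists (u 0%N + d 0%N)|exists n].
by rewrite addrC; apply: ge_sup.
Qed.

(** If the distance from V to the line spanned by U were 0, near-minimizing scalars [b n] would form
    a Cauchy sequence with an explicit rate. Its limit z, obtained from real and imaginary parts by
    [common_point], would satisfy V + z U = 0. *)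
Lemma mx_norm_dist_line (U V : 'M[R[i]]_2) : (forall a, V != a *: U) ->
  exists2 c, 0 < c & forall b, c <= N (V + b *: U).
Proof.
case: N_norm => N_eq0 NZ ND VU; apply: contrapT => nc.
have NU : 0 < N U.
  rewrite lt_neqAle mx_norm_ge0 andbT; apply/eqP => /esym/N_eq0 U0; apply: nc.
  exists (N V) => [|b]; last by rewrite U0 scaler0 addr0.
  rewrite lt_neqAle mx_norm_ge0 andbT; apply/eqP => /esym/N_eq0 V0.
  by have := VU 0; rewrite V0 scale0r eqxx.
have [b bP] : {b : nat -> R[i] & forall n, N (V + b n *: U) <= n.+1%:R^-1}.
  apply: (@choice _ _ (fun n z => N (V + z *: U) <= n.+1%:R^-1)) => n.
  apply: contrapT => h; apply: nc; exists n.+1%:R^-1 => [|b].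
    by rewrite invr_gt0 ltr0n.
  by apply: contrapT => /negP; rewrite -ltNge => /ltW hb; apply: h; exists b.
pose d n := n.+1%:R^-1 / N U.
have bd n m : normc (b n - b m) <= d n + d m.
  rewrite -mulrDl ler_pdivlMr // -NZ.
  have -> : (b n - b m) *: U = (V + b n *: U) - (V + b m *: U).
    by rewrite scalerBl opprD addrACA subrr add0r.
  by apply: le_trans (ND _ _) _; rewrite mx_normN lerD.
have Re_le (z : R[i]) : `|complex.Re z| <= normc z.
  rewrite -(ler_pXn2r (_ : 0 < 2)%N) ?nnegrE ?normc_ge0 ?normr_ge0 //.
  by rewrite normc_sqr real_normK ?num_real // lerDl sqr_ge0.
have Im_le (z : R[i]) : `|complex.Im z| <= normc z.
  rewrite -(ler_pXn2r (_ : 0 < 2)%N) ?nnegrE ?normc_ge0 ?normr_ge0 //.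
  by rewrite normc_sqr real_normK ?num_real // lerDr sqr_ge0.
have [x xP] : exists x, forall n, `|x - complex.Re (b n)| <= d n.
  apply: common_point => n m; rewrite lerBlDr -addrA -lerBlDl addrC -raddfB.
  by apply: le_trans (ler_norm _) _; rewrite (le_trans (Re_le _)) // addrC.
have [y yP] : exists x, forall n, `|x - complex.Im (b n)| <= d n.
  apply: common_point => n m; rewrite lerBlDr -addrA -lerBlDl addrC -raddfB.
  by apply: le_trans (ler_norm _) _; rewrite (le_trans (Im_le _)) // addrC.
pose z := (x +i* y)%C.
(* One share of 1 / (n + 1) comes from the choice of [b n], one from the real and one from the
   imaginary part of z - [b n]. *)
have zP n : N (V + z *: U) <= 3 * n.+1%:R^-1.
  have -> : V + z *: U = (V + b n *: U) + (z - b n) *: U.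
    by rewrite scalerBl addrACA subrr addr0.
  apply: le_trans (ND _ _) _; rewrite NZ.
  have -> : 3 * n.+1%:R^-1 = n.+1%:R^-1 + (d n + d n) * N U.
    have <- : d n * N U = n.+1%:R^-1 by rewrite /d divfK ?gt_eqF.
    ring.
  rewrite lerD // ler_wpM2r ?mx_norm_ge0 //.
  apply: le_trans (_ : `|x - complex.Re (b n)| + `|y - complex.Im (b n)| <= _).
    move: (normc_le_ReIm (x - complex.Re (b n)) (y - complex.Im (b n))).
    by rewrite /z; case: (b n).
  by rewrite lerD.
have : N (V + z *: U) = 0.
  apply/eqP; rewrite eq_le mx_norm_ge0 andbT; apply/ler_addgt0Pr => e e0; rewrite add0r.
  have /archi_boundP : 0 <= 3 / e by rewrite divr_ge0 // ltW.
  set n := Num.bound _ => /ltW h; apply: le_trans (zP n) _.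
  rewrite ler_pdivrMr ?ltr0n // mulrC -ler_pdivrMr //.
  by apply: le_trans h _; rewrite ler_nat.
move=> /N_eq0 /eqP; rewrite addr_eq0 -scaleNr => /eqP VE.
by have := VU (- z); rewrite VE eqxx.
Qed.

(** The identity is not a multiple of the all-ones matrix J, so its distance c to the line of J is
    positive; dividing by x reduces to this case. *)
Lemma mx_norm_ge_scalar_part : exists2 c, 0 < c &
  forall x b : R[i], c * normc x <= N (x%:M + b *: const_mx 1).
Proof.
have [|c c0 cP] := @mx_norm_dist_line (const_mx 1) 1%:M.
  move=> a; apply/eqP => /matrixP E.
  have := E 0 0; have := E 0 1; rewrite !mxE /= => <- /eqP.
  by rewrite oner_eq0.
exists c => // x b; have [->|x0] := eqVneq x 0.
  by rewrite normc0 mulr0 mx_norm_ge0.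
have -> : x%:M + b *: const_mx 1 = x *: (1%:M + (b / x) *: const_mx 1) :> 'M[R[i]]_2.
  apply/matrixP => i j; rewrite !mxE !mulr1 mulrDr mulrCA mulfV // mulr1.
  by rewrite mulrnAr mulr1.
case: N_norm => _ NZ _.
by rewrite NZ mulrC ler_wpM2l ?normc_ge0.
Qed.

End MatrixNorm.

(** * The Fourier cocycle *)

Section Substitution.
Variable R : realType.
Implicit Types (k : R) (F P : {poly R[i]}).

Lemma ord2P (i : 'I_2) : i = 0 \/ i = 1.
Proof. by case: i => [[|[|//]]] ?; [left|right]; apply/val_inj. Qed.

(** Since J^2 = 2 J, matrices x I + b J are closed under products and x is multiplicative. *)
Lemma scalar_add_const_mxM (x y a b : R[i]) :
  (x%:M + a *: const_mx 1) * (y%:M + b *: const_mx 1) =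
  (x * y)%:M + (x * b + a * y + 2 * a * b) *: const_mx 1 :> 'M[R[i]]_2.
Proof.
apply/matrixP => i j; rewrite !mxE !big_ord_recl big_ord0 !mxE.
by case: (ord2P i) => ->; case: (ord2P j) => ->; rewrite /= ?mulr0n ?mulr1n; ring.
Qed.

Definition letter_sign L (w : L.-tuple 'I_2) (i : nat) : bool := nth 0 w i == 1.

Lemma fourier_mx_bijective L (w0 w1 : L.-tuple 'I_2) k :
  bijective_subst (mk_substitution w0 w1) ->
  exists b, fourier_mx (mk_substitution w0 w1) k =
    ((littlewood R L (letter_sign w0)).[ek k])%:M + b *: const_mx 1.
Proof.
move=> bij; pose e (m : 'I_L) : R[i] := expi (2 * pi * k * (m : nat)%:R).
pose b1 := \sum_(m < L | tnth w0 m == 1) e m.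
(* By bijectivity w1 is the letterwise complement of w0: both diagonal entries sum over the zeros of
   w0, both off-diagonal ones over its ones. So b is the latter sum and x the difference of the
   two. *)
have bE (m : 'I_L) (i j : 'I_2) : (tnth (mk_substitution w0 w1 j) m == i) =
    (if i == j then tnth w0 m == 0 else tnth w0 m == 1).
  have := bij m; rewrite /mk_substitution /=.
  case: (ord2P i) => ->; case: (ord2P j) => ->; rewrite //=;
  by case: (ord2P (tnth w0 m)) => ->; case: (ord2P (tnth w1 m)) => ->.
exists b1; apply/matrixP => i j; rewrite !mxE mulr1.
under eq_bigl do rewrite bE.
have [_|_] := eqVneq i j; rewrite ?mulr1n ?mulr0n ?add0r //.
rewrite horner_poly /b1 [in LHS]big_mkcond [X in _ = _ + X]big_mkcond -big_split /=.
apply: eq_bigr => m _.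
have -> : ek k ^+ m = e m by rewrite ekX /e /ek /expi [m%:R * k]mulrC mulrA.
rewrite /letter_sign -tnth_nth.
by case: (ord2P (tnth w0 m)) => -> /=; rewrite ?expr0 ?expr1 /e; ring.
Qed.

Lemma cocycle_bijective L (w0 w1 : L.-tuple 'I_2) n k :
  bijective_subst (mk_substitution w0 w1) ->
  exists b, cocycle L (fourier_mx (mk_substitution w0 w1)) n k =
    (\prod_(l < n) (littlewood R L (letter_sign w0)).[ek k ^+ (L ^ l)])%:M + b *: const_mx 1.
Proof.
move=> bij; rewrite /cocycle big_mkord; elim: n => [|n [b IH]].
  by exists 0; rewrite !big_ord0 scale0r addr0.
have [c cE] := fourier_mx_bijective (L%:R ^+ n * k) bij.
rewrite !big_ord_recr /= IH cE scalar_add_const_mxM -natrX -ekX.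
by eexists.
Qed.

Lemma palindromeP L (w : L.-tuple 'I_2) :
  (forall i, (i < L)%N -> letter_sign w (L.-1 - i) = letter_sign w i) -> palindrome w.
Proof.
move=> h; apply/eqP; apply: (@eq_from_nth _ 0); rewrite ?size_rev // size_tuple => i iL.
rewrite nth_rev ?size_tuple //; move: (h i iL); rewrite /letter_sign.
have -> : (L.-1 - i)%N = (L - i.+1)%N by lia.
by case: (ord2P (nth 0 w (L - i.+1)%N)) => ->; case: (ord2P (nth 0 w i)) => ->.
Qed.

Lemma antipalindromeP L (w : L.-tuple 'I_2) :
  (forall i, (i < L)%N -> letter_sign w (L.-1 - i) = ~~ letter_sign w i) -> antipalindrome w.
Proof.
move=> h; apply/eqP; apply: (@eq_from_nth _ 0); rewrite size_rev ?size_map //.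
rewrite size_tuple => i iL.
rewrite nth_rev ?size_tuple // (nth_map 0) ?size_tuple //.
move: (h i iL); rewrite /letter_sign.
have -> : (L.-1 - i)%N = (L - i.+1)%N by lia.
case: (ord2P (nth 0 w (L - i.+1)%N)) => ->; case: (ord2P (nth 0 w i)) => -> //= _;
  exact/val_inj.
Qed.

Lemma normc_littlewood_le L c (z : R[i]) : normc z = 1 ->
  normc (littlewood R L c).[z] <= L%:R.
Proof.
move=> z1; rewrite horner_poly; elim: L => [|L IH]; first by rewrite big_ord0 normc0.
rewrite big_ord_recr /= (le_trans (le_normcD _ _)) // -natr1 lerD //.
by rewrite normcM !normcX normcN normc1 z1 !expr1n mulr1.
Qed.

End Substitution.

(** * Averages of log^+ over the circle and the final contradiction *)

Section Main.
Variable R : realType.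
Notation mu := (@lebesgue_measure R).
Implicit Types (k : R) (F P : {poly R[i]}).

Definition cocycle_poly L F n : {poly R[i]} := \prod_(l < n) (F \Po 'X^(L ^ l)).

Lemma horner_cocycle_poly L F n (z : R[i]) :
  (cocycle_poly L F n).[z] = \prod_(l < n) F.[z ^+ (L ^ l)].
Proof.
by rewrite horner_prod; apply: eq_bigr => l _; rewrite horner_comp hornerXn.
Qed.

(** The positive part provides the nonnegativity required by [integral_ge_riemann_sum], and makes
    the function vanish wherever the average growth rate is at most X. *)
Definition excess (X : R) H n k : R := Num.max (n%:R^-1 * lnp (normc H.[ek k]) - X) 0.

Lemma excess_lipschitz X (H : {poly R[i]}) n : lipschitz_fun (excess X H n).
Proof.
apply: (@lipschitz_fun_comp R (fun k => lnp (normc H.[ek k]))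
  (fun y => Num.max (n%:R^-1 * y - X) 0)); first exact: lnp_horner_lipschitz.
exists n%:R^-1 => [|x y]; first by rewrite invr_ge0.
rewrite -[n%:R^-1 in leRHS]ger0_norm ?invr_ge0 // -normrM mulrBr.
set a := _ * x; set b := _ * y.
case: (leP (a - X) 0) => ?; case: (leP (b - X) 0) => ?; case: (ler0P (a - b)) => ?;
  rewrite ler_norml; apply/andP; split; lra.
Qed.

(** Replacing the positive part by its argument only lowers the Riemann sums, and [sum_lnp_ge]
    bounds what remains: this is the discrete Jensen inequality. *)
Lemma Rintegral_excess_ge X H n (d : R) : (0 < n)%N -> 0 < normc H.[0] ->
  n%:R * d <= ln (normc H.[0]) ->
  d - X <= \int[mu]_(k in `[0, 2]) excess X H n k.
Proof.
move=> n0 H0 Hd; apply: integral_ge_riemann_sum => [|x|m m0].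
- exact: excess_lipschitz.
- by rewrite /excess le_max lexx orbT.
have [k k01 kP] := sum_lnp_ge H0 m0; exists k => //.
apply: (@le_trans _ _ (\sum_(j < m)
    (n%:R^-1 * lnp (normc H.[ek (k + j%:R * m%:R^-1)]) - X))); last first.
  by apply: ler_sum => j _; rewrite /excess le_max lexx.
rewrite sumrB sumr_const card_ord -mulr_sumr mulrBr -[X *+ m]mulr_natl lerD2r.
rewrite mulrC ler_pdivlMl ?ltr0n //.
by apply: le_trans kP; rewrite mulrA mulrC ler_wpM2l.
Qed.

(** The sequence is eventually equal to 0: the growth rate of A falls below the midpoint Y of chi
    and X, and the gap X - Y absorbs -ln c / n. *)
Lemma excess_cvg0 (X chi : R) H (c : R) (k : R) (A : nat -> R) : 0 <= X -> chi < X -> 0 < c ->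
  (forall n, c * normc (H n).[ek k] <= A n) ->
  ((n%:R^-1)%:E * lne (A n)%:E)%E @[n --> \oo] --> chi%:E ->
  (excess X (H n) n k)%:E @[n --> \oo] --> 0%E.
Proof.
move=> X0 chiX c0 cA Acvg.
apply: cvg_near_cst.
pose Y := (chi + X) / 2.
have chiY : chi < Y by rewrite /Y; lra.
have YX : 0 < X - Y by rewrite /Y; lra.
near=> n.
have n0 : 0 < n%:R :> R by rewrite ltr0n; near: n; exact: nbhs_infty_gt.
have hn : ((n%:R^-1)%:E * lne (A n)%:E < Y%:E)%E.
  by near: n; apply: Acvg _ (nbhs_open_ereal_lt (f := fun=> Y) chiY).
have hc : - ln c <= n%:R * (X - Y).
  rewrite -ler_pdivrMr //.
  by near: n; apply: nbhs_infty_ger.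
congr EFin; apply/max_idPr; rewrite subr_le0 ler_pdivrMl //.
(* Where |H| <= 1 the logarithm is truncated to 0 and X >= 0 suffices; otherwise [A n] is positive
   and [lne] is the real logarithm. *)
have [h1|h1] := leP (normc (H n).[ek k]) 1.
  by rewrite /lnp max_l // ln1 mulr_ge0 // ltW.
have g0 := lt_trans ltr01 h1.
rewrite /lnp max_r; last exact: ltW.
have An0 : 0 < A n by apply: lt_le_trans (cA n); rewrite mulr_gt0.
move: hn; rewrite lne_EFin // -EFinM lte_fin ltr_pdivrMl // => hn.
have : ln (c * normc (H n).[ek k]) <= ln (A n) by rewrite ler_ln ?posrE ?mulr_gt0.
rewrite lnM ?posrE //; lra.
Unshelve. all: by end_near. Qed.

End Main.

Theorem corollary1p2 (R : realType) (L : nat) (w0 w1 : L.-tuple 'I_2)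
    (N : 'M[R[i]]_2 -> R) (chi : R) :
  (2 <= L)%N ->
  primitive_subst (mk_substitution w0 w1) ->
  bijective_subst (mk_substitution w0 w1) ->
  ~~ palindrome w0 ->
  ~~ antipalindrome w0 ->
  is_mx_norm N ->
  is_max_lyapunov L (fourier_mx (mk_substitution w0 w1)) N chi ->
  ln (golden_ratio R) <= chi.
Proof.
move=> L2 _ bij npal napal N_norm lyap.
have L1 : 1 <= L%:R :> R by rewrite ler1n ltnW.
have [F F0 FE] := @littlewood_outer_part R L (letter_sign w0)
  (fun h => negP npal (palindromeP h)) (fun h => negP napal (antipalindromeP h)).
set P := littlewood R L (letter_sign w0) in FE.
have g1 := golden_ratio_gt1 R.
have F00 : 0 < normc F.[0] by apply: lt_le_trans F0; apply: lt_trans g1.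
rewrite leNgt; apply/negP => chig.
have lng : 0 < ln (golden_ratio R) by rewrite ln_gt0.
(* X lies strictly between chi and log tau; the maximum with 0 secures the condition 0 <= X of
   [excess_cvg0]. *)
pose X := (Num.max chi 0 + ln (golden_ratio R)) / 2.
have m_lt : Num.max chi 0 < ln (golden_ratio R) by rewrite gt_max chig.
have m_chi : chi <= Num.max chi 0 by rewrite le_max lexx.
have m_0 : 0 <= Num.max chi 0 by rewrite le_max lexx orbT.
have X0 : 0 <= X by rewrite /X; lra.
have chiX : chi < X by rewrite /X; lra.
have Xg : X < ln (golden_ratio R) by rewrite /X; lra.
pose H n := cocycle_poly L F n.
have HE n k : normc (H n).[ek k] = normc (\prod_(l < n) P.[ek k ^+ (L ^ l)]).
  rewrite horner_cocycle_poly !normc_prod; apply: eq_bigr => l _.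
  by rewrite FE // normcX normc_ek expr1n.
have [c c0 cN] := mx_norm_ge_scalar_part N_norm.
pose f n k : \bar R := (excess X (H n) n k)%:E.
have f_ge0 n k : 0 <= excess X (H n) n k by rewrite /excess le_max lexx orbT.
have f_le n k : excess X (H n) n k <= ln L%:R.
  rewrite /excess ge_max ln_ge0 // andbT.
  apply: (@le_trans _ _ (n%:R^-1 * lnp (normc (H n).[ek k]))).
    by rewrite gerBl.
  (* At n = 0 the inverse is 0 by convention; for n > 0 the domination comes from |P| <= L on the
     circle. *)
  have [->|n0] := posnP n; first by rewrite invr0 mul0r ln_ge0.
  rewrite ler_pdivrMl ?ltr0n // mulr_natl -lnXn ?(lt_le_trans ltr01 L1) //.
  apply: lnp_le; first by rewrite exprn_ege1.
  rewrite HE normc_prod -[in leRHS](card_ord n) -prodr_const; apply: ler_prod => l _.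
  by rewrite normc_ge0 normc_littlewood_le // normcX normc_ek expr1n.
pose D : set R := [set` `[0, 2]].
have f_cvg : {ae lebesgue_measure, forall k, D k -> f n k @[n --> \oo] --> 0%E}.
  move: lyap; apply: filterS; first exact: (ae_filter_ringOfSetsType lebesgue_measure).
  move=> k kP _; apply: (excess_cvg0 X0 chiX c0 _ kP) => n.
  have [b ->] := cocycle_bijective n k bij.
  by rewrite HE cN.
have mf n : measurable_fun D (f n).
  apply/measurable_EFinP; apply: measurable_funTS; apply: continuous_measurable_fun.
  by apply: lipschitz_fun_continuous; apply: excess_lipschitz.
have cst_int : lebesgue_measure.-integrable D (cst (ln L%:R : R)%:E).
  exact: (@continuous_itv_integrable _ (cst (ln L%:R)) _ 0 2 (@cst_continuous _ _ _)).
have f_dom : {ae lebesgue_measure, forall k n, D k ->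
    (`|f n k| <= (cst (ln L%:R : R)%:E) k)%E}.
  by apply: aeW => k n _; rewrite /f /= ger0_norm // lee_fin.
have [_ _] :=
  @dominated_convergence _ _ _ lebesgue_measure D (measurable_itv _) f (cst 0%E)
    _ mf (measurable_cst _) f_cvg cst_int f_dom.
rewrite integral0 => int_cvg.
(* By Jensen, d bounds the integral from below for every n > 0, whereas the integrals tend to 0. *)
pose d := ln (golden_ratio R) - X.
have d0 : 0 < d by rewrite /d; lra.
have /filter_ex[n [n0]] : \forall n \near \oo, (0 < n)%N /\
    (\int[lebesgue_measure]_(k in D) f n k < d%:E)%E.
  near=> n; split; first by near: n; exact: nbhs_infty_gt.
  by near: n; apply: int_cvg _ (nbhs_open_ereal_lt (f := fun=> d) d0).
have Hn0 : (H n).[0] = F.[0] ^+ n.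
  rewrite horner_cocycle_poly -[in RHS](card_ord n) -prodr_const.
  (* Each exponent L^l is positive, so every factor of H_n takes the value F(0) at 0. *)
  by apply: eq_bigr => l _; rewrite expr0n expn_eq0 -leqn0 leqNgt ltnW.
rewrite ltNge => /negP; apply.
have fin_int : (\int[lebesgue_measure]_(k in D) f n k)%E \is a fin_num.
  apply: integrable_fin_num; first exact: measurable_itv.
  apply: (@continuous_itv_integrable _ (excess X (H n) n) `[0, 2] 0 2) => //.
  by apply: lipschitz_fun_continuous; apply: excess_lipschitz.
rewrite -(fineK fin_int) lee_fin; apply: Rintegral_excess_ge => //.
  by rewrite Hn0 normcX exprn_gt0.
rewrite Hn0 normcX lnXn // mulr_natl lerMn2r ?ler_ln ?posrE ?F0 ?orbT //.
exact: lt_trans g1.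
Unshelve. all: by end_near. Qed.
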